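(* Let $\mathfrak g=\mathfrak{so}(N)$, $N=2n$, $i'=N+1-i$, and let $$A=\sum_{\substack{1\le i\le N-1\\ i\ \mathrm{odd}}}z_i(e_{i,i'-1}-e_{i+1,i'}),\qquad z_iz_{i'-1}=-q^{-N+2}\ \text{ for odd } i\le n,$$ where for odd $n$ the coefficient $z_n$ of the diagonal term $e_{nn}-e_{n'n'}$ is $z_n=\sqrt{-1}\,q^{-n+1}$. Let $\Pi_{\mathfrak l}=\{\alpha_{i}: i \text{ odd},\ i\le n-1\}$. Let $U_q(\mathfrak k)\subset U_q(\mathfrak g)$ be the subalgebra generated by $e_i,f_i,q^{\pm h_i}$ with $\alpha_i\in\Pi_{\mathfrak l}$, and by $X_{\alpha_i}=q^{h_{\tilde\alpha_i}-h_{\alpha_i}}e_i+c_{\alpha_i}F_{\tilde\alpha_i}$, $q^{\pm(h_{\tilde\alpha_i}-h_{\alpha_i})}$ with $\alpha_i\notin\Pi_{\mathfrak l}$, with the following data: • for even $i<n-1$: $\tilde\alpha_i=\alpha_{i-1}+\alpha_i+\alpha_{i+1}$, $F_{\tilde\alpha_i}=[[F_i,F_{i+1}]_q,F_{i-1}]_q$, $c_{\alpha_i}=-q\dfrac{z_{i+1}}{z_{i-1}}$; • if $n$ is even: $\tilde\alpha_n=\alpha_n$, $F_{\tilde\alpha_n}=F_n$, $c_{\alpha_n}=-\dfrac{1}{q^{2n-3}z_{n-1}^2}$; • if $n$ is odd: $\tilde\alpha_{n-1}=\alpha_{n-2}+\alpha_n$, $\tilde\alpha_n=\alpha_{n-2}+\alpha_{n-1}$,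 $F_{\tilde\alpha_{n-1}}=[F_n,F_{n-2}]_q$, $F_{\tilde\alpha_n}=[F_{n-1},F_{n-2}]_q$, $c_{\alpha_{n-1}}=-c_{\alpha_n}=\dfrac{\sqrt{-1}}{q^{n-1}z_{n-2}}$. Then $U_q(\mathfrak k)$ fixes $A$: $\pi(x)A=A\pi(x)$ for all $x\in U_q(\mathfrak k)$, where $\pi$ is the natural representation of $U_q(\mathfrak g)$ on $\mathbb C^N$.
   Context: $q\in\mathbb C$ is nonzero and not a root of unity; $\mathfrak{so}(2n)$ is assumed simple. $U_q(\mathfrak{so}(2n))$ has generators $e_i,f_i,q^{\pm h_i}$, $1\le i\le n$, for the simple roots $\alpha_i=\varepsilon_i-\varepsilon_{i+1}$ ($i<n$), $\alpha_n=\varepsilon_{n-1}+\varepsilon_n$, $(\varepsilon_i,\varepsilon_j)=\delta_{ij}$: $q^{h_i}e_jq^{-h_i}=q^{(\alpha_i,\alpha_j)}e_j$, $q^{h_i}f_jq^{-h_i}=q^{-(\alpha_i,\alpha_j)}f_j$, $[e_i,f_j]=\delta_{ij}\frac{q^{h_i}-q^{-h_i}}{q-q^{-1}}$, the $q^{\pm h_i}$ commute, plus the quantum Serre relations. For $\beta=\sum k_i\alpha_i$, $q^{h_\beta}=\prod_i(q^{h_i})^{k_i}$. Notation: $F_i=q^{h_i}f_i$, $[x,y]_a=xy-a\,yx$. With matrix units $e_{jk}$ (two indices), the natural representation $\pi:U_q(\mathfrak g)\to\mathrm{End}(\mathbb C^N)$ is, for $i<n$: $e_i\mapsto e_{i,i+1}-e_{(i+1)',i'}$,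 $f_i\mapsto e_{i+1,i}-e_{i',(i+1)'}$, $q^{h_i}\mapsto\sum_jq^{\delta_{ji}-\delta_{ji'}-\delta_{j,i+1}+\delta_{j,(i+1)'}}e_{jj}$; and $e_n\mapsto e_{n-1,n+1}-e_{(n+1)',(n-1)'}$, $f_n\mapsto e_{n+1,n-1}-e_{(n-1)',(n+1)'}$, $q^{h_n}\mapsto\sum_jq^{\delta_{j,n-1}-\delta_{j,(n-1)'}+\delta_{jn}-\delta_{jn'}}e_{jj}$. *)

(* Defs.v *)
From HB Require Import structures.
From mathcomp Require Import all_boot all_order all_algebra.
From mathcomp Require Import boolp classical_sets reals.
From mathcomp Require Import complex.
From mathcomp Require Import zify ring.

Set Implicit Arguments.
Unset Strict Implicit.
Unset Printing Implicit Defensive.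

Import Order.TTheory GRing.Theory Num.Theory.
Local Open Scope ring_scope.
Local Open Scope quotient_scope.

(* Unital associative algebras given by generators and relations: formal      *)
(* noncommutative polynomial expressions, modulo the least congruence that    *)
(* contains the relations and the axioms of a K-algebra.                      *)

Inductive aterm (K G : Type) : Type :=
| TScal of K
| TGen of G
| TAdd of aterm K G & aterm K G
| TMul of aterm K G & aterm K G.

Arguments TScal {K G}.
Arguments TGen {K G}.

HB.instance Definition _ (K G : Type) := gen_eqMixin (aterm K G).
HB.instance Definition _ (K G : Type) := gen_choiceMixin (aterm K G).

Section PresentedAlgebra.
Variables (K : fieldType) (G : Type).
Variable rel : aterm K G -> aterm K G -> Prop.

Inductive acong : aterm K G -> aterm K G -> Prop :=
| ACrel s t : rel s t -> acong s t
| ACrefl t : acong t t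
| ACsym s t : acong s t -> acong t s
| ACtrans s t u : acong s t -> acong t u -> acong s u
| ACadd s s' t t' : acong s s' -> acong t t' -> acong (TAdd s t) (TAdd s' t')
| ACmul s s' t t' : acong s s' -> acong t t' -> acong (TMul s t) (TMul s' t')
| ACaddA s t u : acong (TAdd s (TAdd t u)) (TAdd (TAdd s t) u)
| ACaddC s t : acong (TAdd s t) (TAdd t s)
| ACadd0 t : acong (TAdd (TScal 0) t) t
| ACaddN t : acong (TAdd (TMul (TScal (-1)) t) t) (TScal 0)
| ACmulA s t u : acong (TMul s (TMul t u)) (TMul (TMul s t) u)
| ACmul1 t : acong (TMul (TScal 1) t) t
| ACmulDl s t u : acong (TMul (TAdd s t) u) (TAdd (TMul s u) (TMul t u))
| ACmulDr s t u : acong (TMul s (TAdd t u)) (TAdd (TMul s t) (TMul s u))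
| ACscalD a b : acong (TScal (a + b)) (TAdd (TScal a) (TScal b))
| ACscalM a b : acong (TScal (a * b)) (TMul (TScal a) (TScal b))
| ACscalC a t : acong (TMul (TScal a) t) (TMul t (TScal a)).

Definition acongb s t := `[< acong s t >].

Lemma acongb_equiv : equiv_class_of acongb.
Proof.
split=> [t|s t|t s u].
- by apply/asboolP; apply: ACrefl.
- by apply/asboolP/asboolP => /ACsym.
- by move=> /asboolP st /asboolP tu; apply/asboolP; apply: ACtrans st tu.
Qed.

Canonical acong_equiv := EquivRelPack acongb_equiv.

Definition palg := {eq_quot acong_equiv}.

HB.instance Definition _ := Choice.on palg.
HB.instance Definition _ := EqQuotient.on palg.

Lemma palg_eqP s t : reflect (acong s t) (\pi_palg s == \pi_palg t).
Proof. by rewrite piE; apply: asboolP. Qed.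

Lemma palg_eq s t : acong s t -> \pi_palg s = \pi_palg t.
Proof. by move/palg_eqP/eqP. Qed.

Lemma acong_repr t : acong (repr (\pi_palg t)) t.
Proof. by apply/palg_eqP; rewrite reprK. Qed.

Definition palg_gen (g : G) : palg := \pi_palg (TGen g).
Definition palg_scal (a : K) : palg := \pi_palg (TScal a).
Definition palg_add (x y : palg) : palg := \pi_palg (TAdd (repr x) (repr y)).
Definition palg_mul (x y : palg) : palg := \pi_palg (TMul (repr x) (repr y)).

Lemma pi_add s t : \pi_palg (TAdd s t) = palg_add (\pi_palg s) (\pi_palg t).
Proof. by apply/palg_eq/ACadd; apply: ACsym; apply: acong_repr. Qed.

Lemma pi_mul s t : \pi_palg (TMul s t) = palg_mul (\pi_palg s) (\pi_palg t).
Proof. by apply/palg_eq/ACmul; apply: ACsym; apply: acong_repr. Qed.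

Lemma palg_addA : associative palg_add.
Proof.
elim/quotW=> s; elim/quotW=> t; elim/quotW=> u.
by rewrite -(pi_add t u) -(pi_add s t) -!pi_add; apply: palg_eq; apply: ACaddA.
Qed.

Lemma palg_addC : commutative palg_add.
Proof.
by elim/quotW=> s; elim/quotW=> t; rewrite -!pi_add; apply: palg_eq; apply: ACaddC.
Qed.

Lemma palg_add0 : left_id (palg_scal 0) palg_add.
Proof. by elim/quotW=> t; rewrite -!pi_add; apply: palg_eq; apply: ACadd0. Qed.

Lemma palg_addN :
  left_inverse (palg_scal 0) (palg_mul (palg_scal (-1))) palg_add.
Proof. by elim/quotW=> t; rewrite -pi_mul -pi_add; apply: palg_eq; apply: ACaddN. Qed.

HB.instance Definition _ :=
  GRing.isZmodule.Build palg palg_addA palg_addC palg_add0 palg_addN.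

Lemma palg_mulA : associative palg_mul.
Proof.
elim/quotW=> s; elim/quotW=> t; elim/quotW=> u.
by rewrite -(pi_mul t u) -(pi_mul s t) -!pi_mul; apply: palg_eq; apply: ACmulA.
Qed.

Lemma palg_mul1 : left_id (palg_scal 1) palg_mul.
Proof. by elim/quotW=> t; rewrite -!pi_mul; apply: palg_eq; apply: ACmul1. Qed.

Lemma palg_scalC a x : palg_mul (palg_scal a) x = palg_mul x (palg_scal a).
Proof. by elim/quotW: x => t; rewrite -!pi_mul; apply: palg_eq; apply: ACscalC. Qed.

Lemma palg_mulr1 : right_id (palg_scal 1) palg_mul.
Proof. by move=> x; rewrite -palg_scalC palg_mul1. Qed.

Lemma palg_mulDl : left_distributive palg_mul +%R.
Proof.
elim/quotW=> s; elim/quotW=> t; elim/quotW=> u.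
rewrite -[X in palg_mul X _]pi_add -[RHS]/(palg_add _ _) -!pi_mul -pi_add.
by apply: palg_eq; apply: ACmulDl.
Qed.

Lemma palg_mulDr : right_distributive palg_mul +%R.
Proof.
elim/quotW=> s; elim/quotW=> t; elim/quotW=> u.
rewrite -[X in palg_mul _ X]pi_add -[RHS]/(palg_add _ _) -!pi_mul -pi_add.
by apply: palg_eq; apply: ACmulDr.
Qed.

HB.instance Definition _ := GRing.Zmodule_isPzRing.Build palg
  palg_mulA palg_mul1 palg_mulr1 palg_mulDl palg_mulDr.

Definition palg_scale (a : K) (x : palg) : palg := palg_scal a * x.

Lemma palg_scalM a b : palg_scal (a * b) = palg_scal a * palg_scal b.
Proof. by rewrite -[RHS]/(palg_mul _ _) -pi_mul; apply: palg_eq; apply: ACscalM. Qed.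

Lemma palg_scalD a b : palg_scal (a + b) = palg_scal a + palg_scal b.
Proof. by rewrite -[RHS]/(palg_add _ _) -pi_add; apply: palg_eq; apply: ACscalD. Qed.

Lemma palg_scaleA a b x : palg_scale a (palg_scale b x) = palg_scale (a * b) x.
Proof. by rewrite /palg_scale palg_scalM mulrA. Qed.

Lemma palg_scale1 : left_id 1 palg_scale.
Proof. by move=> x; rewrite /palg_scale mul1r. Qed.

Lemma palg_scaleDr : right_distributive palg_scale +%R.
Proof. by move=> a x y; rewrite /palg_scale mulrDr. Qed.

Lemma palg_scaleDl x : {morph palg_scale^~ x : a b / a + b}.
Proof. by move=> a b; rewrite /palg_scale palg_scalD mulrDl. Qed.

HB.instance Definition _ := GRing.Zmodule_isLmodule.Build K palg
  palg_scaleA palg_scale1 palg_scaleDr palg_scaleDl.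

Lemma palg_scaleAl (a : K) (x y : palg) : a *: (x * y) = a *: x * y.
Proof. exact: mulrA. Qed.

Lemma palg_scaleAr (a : K) (x y : palg) : a *: (x * y) = x * (a *: y).
Proof.
rewrite -[LHS]/(palg_scal a * (x * y)) -[_ *: y]/(palg_scal a * y) !mulrA.
by congr (_ * _); apply: palg_scalC.
Qed.

(* Target rings A are K-algebras via a central morphism iota, because matrix  *)
(* rings of unspecified size have no algType instance.                        *)

Section Eval.
Variables (A : pzRingType) (iota : {rmorphism K -> A}) (f : G -> A).

Fixpoint aeval (t : aterm K G) : A :=
  match t with
  | TScal a => iota a
  | TGen g => f g
  | TAdd s t => aeval s + aeval t
  | TMul s t => aeval s * aeval t
  end.

Definition respects_rel := forall s t, rel s t -> aeval s = aeval t.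

Definition palg_lift (iotaC : forall a x, iota a * x = x * iota a)
  (fr : respects_rel) : palg -> A := fun x => aeval (repr x).

Hypothesis iotaC : forall a x, iota a * x = x * iota a.
Hypothesis fr : respects_rel.

Lemma aeval_acong s t : acong s t -> aeval s = aeval t.
Proof.
elim=> {s t} //=.
- by move=> s t u _ -> _ ->.
- by move=> s s' t t' _ -> _ ->.
- by move=> s s' t t' _ -> _ ->.
- by move=> s t u; rewrite addrA.
- by move=> s t; rewrite addrC.
- by move=> t; rewrite rmorph0 add0r.
- by move=> t; rewrite rmorphN1 mulN1r addNr rmorph0.
- by move=> s t u; rewrite mulrA.
- by move=> t; rewrite rmorph1 mul1r.
- by move=> s t u; rewrite mulrDl.
- by move=> s t u; rewrite mulrDr.
- by move=> a b; rewrite rmorphD.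
- by move=> a b; rewrite rmorphM.
Qed.

Lemma palg_lift_pi t : palg_lift iotaC fr (\pi_palg t) = aeval t.
Proof. exact/aeval_acong/acong_repr. Qed.

Lemma palg_lift_gen g : palg_lift iotaC fr (palg_gen g) = f g.
Proof. exact: palg_lift_pi. Qed.

Lemma palg_liftZ a x :
  palg_lift iotaC fr (a *: x) = iota a * palg_lift iotaC fr x.
Proof.
elim/quotW: x => s; rewrite -[_ *: _]/(palg_mul (palg_scal a) _).
by rewrite -pi_mul !palg_lift_pi.
Qed.

Lemma palg_lift_zmod : zmod_morphism (palg_lift iotaC fr).
Proof.
elim/quotW=> s; elim/quotW=> t.
rewrite -[_ - _]/(palg_add _ (palg_mul (palg_scal (-1)) _)).
by rewrite -pi_mul -pi_add !palg_lift_pi /= rmorphN1 mulN1r.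
Qed.

Lemma palg_lift_monoid : monoid_morphism (palg_lift iotaC fr).
Proof.
split; first by rewrite [LHS]palg_lift_pi /= rmorph1.
elim/quotW=> s; elim/quotW=> t.
by rewrite -[_ * _]/(palg_mul _ _) -pi_mul !palg_lift_pi.
Qed.

HB.instance Definition _ :=
  GRing.isZmodMorphism.Build palg A (palg_lift iotaC fr) palg_lift_zmod.
HB.instance Definition _ :=
  GRing.isMonoidMorphism.Build palg A (palg_lift iotaC fr) palg_lift_monoid.

End Eval.

End PresentedAlgebra.

(* As in the mathematical notation, simple roots, coordinates, and the rows   *)
(* and columns of matrices are numbered from 1 by natural numbers; elements   *)
(* and matrices attached to a number out of range have no meaning.            *)

Record sindex (n : nat) :=
  SIndex { sindex_val :> nat; _ : (0 < sindex_val <= n)%N }.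
HB.instance Definition _ n := [isSub for @sindex_val n].
HB.instance Definition _ n := [Equality of sindex n by <:].

Definition kron (i j : nat) : int := (i == j)%:Z.

Definition simple_root (n i : nat) : nat -> int := fun k =>
  if (i < n)%N then kron k i - kron k i.+1 else kron k n.-1 + kron k n.

Definition rform (n : nat) (x y : nat -> int) : int :=
  \sum_(1 <= k < n.+1) x k * y k.

Variant uqgen (n : nat) : Type :=
| GenE of sindex n | GenF of sindex n | GenK of sindex n | GenKi of sindex n.

Section QuantumGroup.
Variables (C : numClosedFieldType) (n : nat) (q : C).

Local Notation term := (aterm C (uqgen n)).
Local Notation E i := (TGen (GenE i)).
Local Notation F i := (TGen (GenF i)).
Local Notation Kp i := (TGen (GenK i)).
Local Notation Kn i := (TGen (GenKi i)).
Local Notation "x '*t' y" := (TMul x y) (at level 40, left associativity).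
Local Notation "x '+t' y" := (TAdd x y) (at level 50, left associativity).
Local Notation "a '*s' x" := (TMul (TScal a) x) (at level 40).
Local Notation "x '-t' y" := (TAdd x (TMul (TScal (-1)) y))
  (at level 50, left associativity).
Local Notation dot i j := (rform n (simple_root n i) (simple_root n j)).

(* The root system is simply laced (for n >= 3): the Serre relations are the  *)
(* commutation of orthogonal generators and the cubic relations.              *)
Inductive uq_rel : term -> term -> Prop :=
| RKKi i : uq_rel (Kp i *t Kn i) (TScal 1)
| RKiK i : uq_rel (Kn i *t Kp i) (TScal 1)
| RKK i j : uq_rel (Kp i *t Kp j) (Kp j *t Kp i)
| RKE i j : uq_rel (Kp i *t E j *t Kn i) (q ^ dot i j *s E j)
| RKF i j : uq_rel (Kp i *t F j *t Kn i) (q ^ (- dot i j) *s F j)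
| REF (i j : sindex n) : uq_rel (E i *t F j -t F j *t E i)
    (((i == j)%:R / (q - q^-1)) *s (Kp i -t Kn i))
| RSerreE0 (i j : sindex n) of i != j & dot i j = 0 :
    uq_rel (E i *t E j) (E j *t E i)
| RSerreF0 (i j : sindex n) of i != j & dot i j = 0 :
    uq_rel (F i *t F j) (F j *t F i)
| RSerreE1 (i j : sindex n) of i != j & dot i j = -1 : uq_rel
    (E i *t E i *t E j -t (q + q^-1) *s (E i *t E j *t E i)
       +t E j *t E i *t E i) (TScal 0)
| RSerreF1 (i j : sindex n) of i != j & dot i j = -1 : uq_rel
    (F i *t F i *t F j -t (q + q^-1) *s (F i *t F j *t F i)
       +t F j *t F i *t F i) (TScal 0).

Definition Uq := palg uq_rel.

HB.instance Definition _ := GRing.PzRing.on Uq.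
HB.instance Definition _ := GRing.Lmodule.on Uq.

(* The counit, used to see that Uq is not the zero ring.                      *)

Definition counit_gen (g : uqgen n) : C :=
  match g with GenE _ | GenF _ => 0 | GenK _ | GenKi _ => 1 end.

Lemma counit_rel : respects_rel uq_rel (@idfun C) counit_gen.
Proof. by move=> s t [] * /=; ring. Qed.

Lemma Uq_nonzero : (1 : Uq) != 0.
Proof.
have iC (a x : C) : idfun a * x = x * idfun a by rewrite mulrC.
apply: contra_neq (oner_neq0 C) => u10.
by rewrite -(rmorph1 (palg_lift iC counit_rel)) u10 rmorph0.
Qed.

HB.instance Definition _ := GRing.PzSemiRing_isNonZero.Build Uq Uq_nonzero.
HB.instance Definition _ :=
  GRing.Lmodule_isLalgebra.Build C Uq (@palg_scaleAl _ _ uq_rel).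
HB.instance Definition _ :=
  GRing.Lalgebra_isAlgebra.Build C Uq (@palg_scaleAr _ _ uq_rel).

Definition at_sindex (T : Type) (x0 : T) (f : sindex n -> T) (i : nat) : T :=
  oapp f x0 (insub i).

Definition ue : nat -> Uq := at_sindex 0 (fun i => palg_gen uq_rel (GenE i)).
Definition uf : nat -> Uq := at_sindex 0 (fun i => palg_gen uq_rel (GenF i)).
Definition uk : nat -> Uq := at_sindex 1 (fun i => palg_gen uq_rel (GenK i)).
Definition uki : nat -> Uq := at_sindex 1 (fun i => palg_gen uq_rel (GenKi i)).

(* q^{h_beta}, where beta is given by its coefficients in the simple roots.   *)
Definition ukpow (i : nat) (m : int) : Uq :=
  match m with Posz p => uk i ^+ p | Negz p => uki i ^+ p.+1 end.
Definition uqh (beta : nat -> int) : Uq :=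
  \prod_(1 <= i < n.+1) ukpow i (beta i).

End QuantumGroup.

Section NaturalRep.
Variables (C : numClosedFieldType) (n : nat) (q : C).

(* i' = N + 1 - i for N = 2n. *)
Definition bar (i : nat) : nat := (n.*2.+1 - i)%N.

Definition matE (j k : nat) : 'M[C]_(n.*2) :=
  \matrix_(a, b) ((a.+1 == j) && (b.+1 == k))%:R.

Definition mat_e (i : nat) : 'M[C]_(n.*2) :=
  if (i < n)%N then matE i i.+1 - matE (bar i.+1) (bar i)
  else matE n.-1 n.+1 - matE (bar n.+1) (bar n.-1).

Definition mat_f (i : nat) : 'M[C]_(n.*2) :=
  if (i < n)%N then matE i.+1 i - matE (bar i) (bar i.+1)
  else matE n.+1 n.-1 - matE (bar n.-1) (bar n.+1).

Definition expo_h (i j : nat) : int :=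
  if (i < n)%N
  then kron j i - kron j (bar i) - kron j i.+1 + kron j (bar i.+1)
  else kron j n.-1 - kron j (bar n.-1) + kron j n - kron j (bar n).

Definition mat_k (i : nat) : 'M[C]_(n.*2) :=
  \sum_(1 <= j < n.*2.+1) q ^ expo_h i j *: matE j j.

Definition mat_ki (i : nat) : 'M[C]_(n.*2) :=
  \sum_(1 <= j < n.*2.+1) q ^ (- expo_h i j) *: matE j j.

Definition natrep_gen (g : uqgen n) : 'M[C]_(n.*2) :=
  match g with
  | GenE i => mat_e i | GenF i => mat_f i
  | GenK i => mat_k i | GenKi i => mat_ki i
  end.

Hypothesis n_ge3 : (3 <= n)%N.
Hypothesis q_neq0 : q != 0.
Hypothesis q_nroot : forall m, (0 < m)%N -> q ^+ m != 1.

Let ra (i : nat) := if (i < n)%N then i else n.-1.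
Let rb (i : nat) := if (i < n)%N then i.+1 else n.+1.

Lemma mulE j k l m : (0 < k <= n.*2)%N ->
  matE j k *m matE l m = (k == l)%:R *: matE j m.
Proof.
move=> hk; apply/matrixP => a b; rewrite !mxE.
have hk' : (k.-1 < n.*2)%N by lia.
rewrite (bigD1 (Ordinal hk')) //= big1 => [|c hc]; rewrite !mxE.
  have -> : k.-1.+1 = k by lia.
  by rewrite eqxx andbT addr0 -!natrM !mulnb andbCA.
have -> : (c.+1 == k) = false.
  by apply/negP => /eqP ck; move/eqP: hc; apply; apply: val_inj => /=; lia.
by rewrite andbF mul0r.
Qed.

Definition dgm (x : nat -> C) : 'M[C]_(n.*2) := diag_mx (\row_a x a.+1).

Lemma diagE (x : nat -> C) :
  \sum_(1 <= j < n.*2.+1) x j *: matE j j = dgm x.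
Proof.
rewrite big_add1 /= big_mkord; apply/matrixP => a b; rewrite !mxE summxE.
rewrite (bigD1 a) //= big1 => [|c hc]; rewrite !mxE !eqSS.
  by rewrite eqxx /= addr0 mulr_natr -val_eqE eq_sym.
by rewrite val_eqE [a == c]eq_sym (negbTE hc) mulr0.
Qed.

Lemma conjE (x y : nat -> C) j k : (0 < j <= n.*2)%N -> (0 < k <= n.*2)%N ->
  dgm x *m matE j k *m dgm y = (x j * y k) *: matE j k.
Proof.
move=> hj hk; rewrite mul_diag_mx mul_mx_diag; apply/matrixP => a b.
rewrite !mxE; case: eqP => [<-|_] /=; last by rewrite !(mulr0, mul0r).
by case: eqP => [<-|_] /=; rewrite ?(mulr0, mul0r, mulr1).
Qed.

Lemma kE i : mat_k i = dgm (fun j => q ^ expo_h i j).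
Proof. exact: (diagE (fun j => q ^ expo_h i j)). Qed.

Lemma kiE i : mat_ki i = dgm (fun j => q ^ (- expo_h i j)).
Proof. exact: (diagE (fun j => q ^ (- expo_h i j))). Qed.

Lemma mat_eE i :
  mat_e i = matE (ra i) (rb i) - matE (bar (rb i)) (bar (ra i)).
Proof. by rewrite /mat_e /ra /rb; case: ifP. Qed.

Lemma mat_fE i :
  mat_f i = matE (rb i) (ra i) - matE (bar (ra i)) (bar (rb i)).
Proof. by rewrite /mat_f /ra /rb; case: ifP. Qed.

Lemma expo_hE i j : expo_h i j =
  kron j (ra i) - kron j (bar (ra i)) - kron j (rb i) + kron j (bar (rb i)).
Proof.
rewrite /expo_h /ra /rb; case: ifP => // _.
rewrite (_ : bar n.+1 = n) 1?(_ : bar n = n.+1) /bar; [ring|lia|lia].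
Qed.

Lemma sum_kron (x : nat -> int) i : (0 < i <= n)%N ->
  \sum_(1 <= k < n.+1) x k * kron k i = x i.
Proof.
move=> hi; rewrite (bigD1_seq i) ?iota_uniq ?mem_index_iota //=.
rewrite big1 => [|k /negbTE ki]; first by rewrite /kron eqxx mulr1 addr0.
by rewrite /kron ki mulr0.
Qed.

Lemma rformE x j : (0 < j <= n)%N -> rform n x (simple_root n j) =
  if (j < n)%N then x j - x j.+1 else x n.-1 + x n.
Proof.
move=> hj; rewrite /rform /simple_root; case: ifP => hjn.
  under eq_bigr do rewrite mulrBr.
  by rewrite sumrB !sum_kron //; lia.
under eq_bigr do rewrite mulrDr.
by rewrite big_split /= !sum_kron //; lia.
Qed.

Let dot i j := rform n (simple_root n i) (simple_root n j).

Lemma kron0 i j : i != j -> kron i j = 0.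
Proof. by rewrite /kron => /negbTE ->. Qed.

Lemma kron_bar i j : (0 < i <= n.*2)%N -> (0 < j <= n.*2)%N ->
  kron (bar i) j = kron i (bar j).
Proof.
move=> hi hj; rewrite /kron (_ : (bar i == j) = (i == bar j)) //.
by rewrite /bar; apply/eqP/eqP; lia.
Qed.

Lemma barK i : (0 < i <= n.*2)%N -> bar (bar i) = i.
Proof. by rewrite /bar; lia. Qed.

Lemma expo_h_root i j : (0 < i <= n)%N -> (0 < j <= n)%N ->
  expo_h i j = simple_root n i j.
Proof.
move=> hi hj; rewrite /expo_h /simple_root; case: ifP => hin.
  rewrite [kron j (bar i)]kron0 1?[kron j (bar i.+1)]kron0; first by ring.
    by apply/eqP; rewrite /bar; lia.
  by apply/eqP; rewrite /bar; lia.
rewrite [kron j (bar n)]kron0 1?[kron j (bar n.-1)]kron0; first by ring.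
  by apply/eqP; rewrite /bar; lia.
by apply/eqP; rewrite /bar; lia.
Qed.

Lemma expo_h_bar i j : (0 < i <= n)%N -> (0 < j <= n.*2)%N ->
  expo_h i (bar j) = - expo_h i j.
Proof.
move=> hi hj; rewrite !expo_hE.
have hp x : (0 < x <= n.*2)%N -> (0 < bar x <= n.*2)%N by rewrite /bar; lia.
have ha : (0 < ra i <= n.*2)%N by rewrite /ra; case: ifP; lia.
have hb : (0 < rb i <= n.*2)%N by rewrite /rb; case: ifP; lia.
by rewrite !kron_bar ?hp // !barK //; ring.
Qed.

Lemma expo_h_dot i j : (0 < i <= n)%N -> (0 < j <= n)%N ->
  expo_h i (ra j) - expo_h i (rb j) = dot i j /\
  expo_h i (bar (rb j)) - expo_h i (bar (ra j)) = dot i j.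
Proof.
move=> hi hj.
have -> : expo_h i (ra j) - expo_h i (rb j) = dot i j.
  rewrite /dot rformE // /ra /rb; case: ifP => hjn.
    by rewrite !expo_h_root //; lia.
  rewrite (_ : n.+1 = bar n); last by rewrite /bar; lia.
  by rewrite expo_h_bar // ?opprK ?expo_h_root //; lia.
split=> //; rewrite !expo_h_bar //; try by rewrite /ra /rb; case: ifP; lia.
rewrite opprK addrC -/(_ - _).
rewrite /dot rformE // /ra /rb; case: ifP => hjn.
  by rewrite !expo_h_root //; lia.
rewrite (_ : n.+1 = bar n); last by rewrite /bar; lia.
by rewrite expo_h_bar // ?opprK ?expo_h_root //; lia.
Qed.

Lemma conj_e i j : (0 < i <= n)%N -> (0 < j <= n)%N ->
  mat_k i *m mat_e j *m mat_ki i = q ^ dot i j *: mat_e j.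
Proof.
move=> hi hj; rewrite kE kiE mat_eE mulmxBr mulmxBl.
rewrite !conjE; try by rewrite /bar /ra /rb; case: ifP; lia.
have [h1 h2] := expo_h_dot hi hj.
by rewrite -!expfzDr // !(h1, h2) scalerBr.
Qed.

Lemma conj_f i j : (0 < i <= n)%N -> (0 < j <= n)%N ->
  mat_k i *m mat_f j *m mat_ki i = q ^ (- dot i j) *: mat_f j.
Proof.
move=> hi hj; rewrite kE kiE mat_fE mulmxBr mulmxBl.
rewrite !conjE; try by rewrite /bar /ra /rb; case: ifP; lia.
have [h1 h2] := expo_h_dot hi hj.
rewrite -!expfzDr // scalerBr.
by congr (q ^ _ *: _ - q ^ _ *: _); lia.
Qed.

Lemma dgmM x y : dgm x *m dgm y = dgm (fun j => x j * y j).
Proof.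
rewrite /dgm mul_diag_mx; apply/matrixP => a b; rewrite !mxE.
by rewrite mulrnAr.
Qed.

Lemma dgm1 : dgm (fun=> 1) = 1%:M.
Proof. by apply/matrixP => a b; rewrite !mxE. Qed.

Lemma mat_kki i : mat_k i *m mat_ki i = 1%:M.
Proof.
rewrite kE kiE dgmM -dgm1; congr dgm; apply: funext => j.
by rewrite -expfzDr // subrr.
Qed.

Lemma mat_kik i : mat_ki i *m mat_k i = 1%:M.
Proof.
rewrite kE kiE dgmM -dgm1; congr dgm; apply: funext => j.
by rewrite -expfzDr // addNr.
Qed.

Lemma mat_kk i j : mat_k i *m mat_k j = mat_k j *m mat_k i.
Proof. by rewrite !kE !dgmM; congr dgm; apply: funext => k; rewrite mulrC. Qed.

Definition rtm a b := matE a b - matE (bar b) (bar a).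

Lemma rtmM a b c d : (0 < a <= n.*2)%N -> (0 < b <= n.*2)%N ->
  rtm a b *m rtm c d =
  (b == c)%:R *: matE a d - (b == bar d)%:R *: matE a (bar c)
  - (bar a == c)%:R *: matE (bar b) d
  + (bar a == bar d)%:R *: matE (bar b) (bar c).
Proof.
move=> ha hb; rewrite /rtm mulmxBr !mulmxBl !mulE //; try by rewrite /bar; lia.
by rewrite opprB addrA addrAC; congr (_ + _); rewrite addrAC.
Qed.

Ltac decb := repeat match goal with |- context[@eq_op ?T ?x ?y] =>
  first [ have -> : @eq_op T x y = false by rewrite /bar; lia
        | have -> : @eq_op T x y = true by rewrite /bar; lia ] end.

Let rb_bnd i : (0 < i <= n)%N ->
  [/\ (0 < ra i <= n)%N, (ra i < rb i)%N, (rb i <= n.+1)%N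
    & (ra i + rb i)%N <> n.*2.+1].
Proof. by rewrite /ra /rb; case: ifP; split; lia. Qed.

Lemma rtm_sqr a b c d : (0 < a < b)%N -> (b <= n.*2)%N -> (a + b)%N <> n.*2.+1 ->
  (0 < c < d)%N -> (d <= n.*2)%N -> (c + d)%N <> n.*2.+1 ->
  rtm a b *m rtm c d *m rtm a b = 0.
Proof.
move=> h1 h2 h3 h4 h5 h6; rewrite rtmM; try lia.
rewrite !(mulmxBl, mulmxDl) -!scalemxAl /rtm !mulmxBr.
rewrite !mulE; try by rewrite /bar; lia.
rewrite !scalerBr !scalerA -!natrM !mulnb.
repeat match goal with |- context[@eq_op ?T ?x ?y && @eq_op ?T ?u ?v] =>
  have -> : @eq_op T x y && @eq_op T u v = false by rewrite /bar; lia
end.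
by rewrite !scale0r !subr0 !addr0.
Qed.

Lemma mat_e_rtm i : mat_e i = rtm (ra i) (rb i).
Proof. exact: mat_eE. Qed.

Lemma mat_f_tr i : mat_f i = (mat_e i)^T.
Proof.
have trE j k : (matE j k)^T = matE k j.
  by apply/matrixP => a b; rewrite !mxE andbC.
by rewrite mat_fE mat_eE linearB /= !trE.
Qed.

Lemma serre_e2 i : (0 < i <= n)%N -> mat_e i *m mat_e i = 0.
Proof.
move=> /rb_bnd[h1 h2 h3 h4]; rewrite mat_e_rtm rtmM; try lia.
by decb; rewrite !scale0r !subr0 addr0.
Qed.

Lemma serre_e3 i j : (0 < i <= n)%N -> (0 < j <= n)%N ->
  mat_e i *m mat_e j *m mat_e i = 0.
Proof.
move=> /rb_bnd[h1 h2 h3 h4] /rb_bnd[h5 h6 h7 h8].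
by rewrite !mat_e_rtm rtm_sqr //; lia.
Qed.

Lemma serre_e0 i j : (0 < i <= n)%N -> (0 < j <= n)%N -> dot i j = 0 ->
  mat_e i *m mat_e j = mat_e j *m mat_e i.
Proof.
move=> hi hj.
wlog hij : i j hi hj / (i <= j)%N => [hw|].
  have [/hw|/ltnW ij d0] := leqP i j; first exact.
  apply/esym/hw => //; rewrite -d0 /dot /rform.
  by apply: eq_bigr => k _; rewrite mulrC.
have [->//|nij] := eqVneq i j.
rewrite /dot rformE // !mat_e_rtm !rtmM;
  try by [rewrite /ra /rb; repeat case: ifP; lia].
rewrite /simple_root /kron /ra /rb.
have -> : (i < n)%N by lia.
have [hjn|hjn] := ltnP j n => d0.
  have dij : (i.+1 < j)%N by lia.
  by decb; rewrite !scale0r !subr0 !addr0.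
have ejn : j = n by lia.
have [ei|ni] := eqVneq i n.-1.
  rewrite ei; decb; rewrite !scale0r !scale1r !subr0 !addr0 sub0r.
  by congr (- matE _ _); rewrite /bar; lia.
have dij : (i.+2 < n)%N by lia.
by decb; rewrite !scale0r !subr0 !addr0.
Qed.

Lemma comm_ef i j : (0 < i <= n)%N -> (0 < j <= n)%N ->
  mat_e i *m mat_f j - mat_f j *m mat_e i =
  ((i == j)%:R / (q - q^-1)) *: (mat_k i - mat_ki i).
Proof.
move=> hi hj.
have fE k : mat_f k = rtm (rb k) (ra k) by exact: mat_fE.
have [h1 h2 h3 h4] := rb_bnd hi; have [h5 h6 h7 h8] := rb_bnd hj.
rewrite mat_e_rtm fE !rtmM; try lia.
have [<-|nij] := eqVneq i j; last first.
  rewrite mul0r scale0r; move: h1 h2 h3 h4 h5 h6 h7 h8; rewrite /ra /rb.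
  have [hin|hin] := ltnP i n;
  have [hjn|hjn] := ltnP j n => h1 h2 h3 h4 h5 h6 h7 h8.
  - by decb; rewrite !scale0r !subr0 !addr0 subr0.
  - have [ei|ni] := eqVneq i n.-1.
      rewrite ei; decb; rewrite !scale0r !scale1r !subr0 !addr0 !add0r.
      by apply/eqP; rewrite subr_eq0; apply/eqP; congr matE; rewrite /bar; lia.
    by decb; rewrite !scale0r !subr0 !addr0 subr0.
  - have [ej|nj] := eqVneq j n.-1.
      rewrite ej; decb; rewrite !scale0r !scale1r !subr0 !addr0 !add0r.
      by apply/eqP; rewrite subr_eq0; apply/eqP; congr matE; rewrite /bar; lia.
    by decb; rewrite !scale0r !subr0 !addr0 subr0.
  - lia.
decb; rewrite !scale0r !scale1r !subr0.
have mE a : (0 < a <= n.*2)%N -> matE a a = dgm (fun k => (k == a)%:R).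
  move=> ha; rewrite -diagE (bigD1_seq a) ?iota_uniq ?mem_index_iota //=.
  rewrite eqxx scale1r big1 ?addr0 // => k /negbTE ->.
  by rewrite scale0r.
rewrite !mE; try by rewrite /bar; lia.
rewrite kE kiE; apply/matrixP => s t; rewrite !mxE.
have [_|] := eqVneq s t; last by rewrite !mulr0n !(addr0, subr0, mulr0).
rewrite !mulr1n expo_hE /kron.
have q1 : q - q^-1 != 0.
  rewrite subr_eq0; apply: contra (q_nroot (isT : (0 < 2)%N)) => /eqP qq.
  by rewrite expr2 {1}qq mulVf.
have -> : 1 / (q - q^-1) = (q - q^-1)^-1 by rewrite mul1r.
have hx (x : int) : (-1 <= x <= 1) ->
    (q - q^-1)^-1 * (q ^ x - q ^ (- x)) = x%:~R.
  move=> hx; have : x = 1 \/ x = 0 \/ x = -1 by lia.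
  case=> [->|[->|->]].
  - by rewrite -[q ^ (- 1)]/(q^-1) expr1z mulVf.
  - by rewrite oppr0 subrr mulr0.
  - by rewrite opprK -[q ^ (-1)]/(q^-1) expr1z -[q^-1 - q]opprB mulrN mulVf.
rewrite hx; last by move: h1 h2 h3 h4; rewrite /bar; lia.
by rewrite !rmorphD !rmorphN /= -!pmulrn; ring.
Qed.

Lemma mat_serre1 (x y : 'M[C]_(n.*2)) (a : C) : x *m x = 0 -> x *m y *m x = 0 ->
  x *m x *m y + (-1)%:M *m (a%:M *m (x *m y *m x)) + y *m x *m x = 0.
Proof.
by move=> xx xyx; rewrite xx xyx -mulmxA xx !mulmx0 mul0mx !addr0.
Qed.

Lemma natrep_rel : respects_rel (@uq_rel C n q) (@scalar_mx C n.*2) natrep_gen.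
Proof.
have bnd (i : sindex n) : (0 < i <= n)%N by case: i.
have subE (x y : 'M[C]_(n.*2)) : x + (-1)%:M *m y = x - y.
  by rewrite mul_scalar_mx scaleN1r.
move=> s t [] * /=.
- exact: mat_kki.
- exact: mat_kik.
- exact: mat_kk.
- by rewrite [LHS]conj_e // [RHS]mul_scalar_mx.
- by rewrite [LHS]conj_f // [RHS]mul_scalar_mx.
- by rewrite [LHS]subE [LHS]comm_ef // [RHS]mul_scalar_mx [X in _ = _ *: X]subE.
- exact: serre_e0.
- rewrite !mat_f_tr -[LHS]trmx_mul -[RHS]trmx_mul.
  by congr trmx; apply/esym/serre_e0.
- by rewrite rmorph0; apply: mat_serre1; [apply: serre_e2|apply: serre_e3].
- rewrite rmorph0 !mat_f_tr; apply: mat_serre1.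
    by rewrite -trmx_mul serre_e2 ?trmx0.
  by rewrite -!trmx_mul mulmxA serre_e3 ?trmx0.
Qed.

Lemma scalar_mx_central (a : C) (x : 'M[C]_(n.*2)) : a%:M * x = x * a%:M.
Proof. by rewrite [RHS]scalar_mxC. Qed.

Definition natrep : Uq n q -> 'M[C]_(n.*2) :=
  palg_lift scalar_mx_central natrep_rel.

HB.instance Definition _ := GRing.RMorphism.on natrep.

Lemma natrepZ a x : natrep (a *: x) = a *: natrep x.
Proof. by rewrite /natrep palg_liftZ [LHS]mul_scalar_mx. Qed.

HB.instance Definition _ :=
  GRing.isScalable.Build C (Uq n q) 'M[C]_(n.*2) *:%R natrep natrepZ.

Lemma natrep_ue i : (0 < i <= n)%N -> natrep (ue n q i) = mat_e i.
Proof.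
move=> hi; rewrite /ue /at_sindex; case: insubP => [j _ <-|]; last by rewrite hi.
by rewrite /natrep palg_lift_gen.
Qed.

Lemma natrep_uf i : (0 < i <= n)%N -> natrep (uf n q i) = mat_f i.
Proof.
move=> hi; rewrite /uf /at_sindex; case: insubP => [j _ <-|]; last by rewrite hi.
by rewrite /natrep palg_lift_gen.
Qed.

Lemma natrep_uk i : (0 < i <= n)%N -> natrep (uk n q i) = mat_k i.
Proof.
move=> hi; rewrite /uk /at_sindex; case: insubP => [j _ <-|]; last by rewrite hi.
by rewrite /natrep palg_lift_gen.
Qed.

Lemma natrep_uki i : (0 < i <= n)%N -> natrep (uki n q i) = mat_ki i.
Proof.
move=> hi; rewrite /uki /at_sindex; case: insubP => [j _ <-|]; last by rewrite hi.
by rewrite /natrep palg_lift_gen.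
Qed.

End NaturalRep.

Definition subalg_gen (K : fieldType) (A : algType K) (S : set A) : set A :=
  smallest [set B : set A | GRing.subalg_closed (mem B)]%classic S.

Section CoidealSubalgebra.
Variables (C : numClosedFieldType) (n : nat) (q : C) (z : nat -> C).

Definition qbracket (a : C) (x y : Uq n q) : Uq n q := x * y - a *: (y * x).

Definition uF (i : nat) : Uq n q := uk n q i * uf n q i.

Definition in_Pi_l (i : nat) : bool := odd i && (i <= n.-1)%N.

(* tilde_alpha, uF_tilde and c_alpha are only meaningful for 1 <= i <= n with *)
(* in_Pi_l i = false. Apart from the exceptional values listed first, these   *)
(* are the even i < n - 1. Roots are given here by their coefficients in the  *)
(* simple roots.                                                              *)
Definition tilde_alpha (i : nat) : nat -> int := fun j =>
  if odd n then
    if i == n.-1 then kron j n.-2 + kron j n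
    else if i == n then kron j n.-2 + kron j n.-1
    else kron j i.-1 + kron j i + kron j i.+1
  else
    if i == n then kron j n
    else kron j i.-1 + kron j i + kron j i.+1.

Definition uF_tilde (i : nat) : Uq n q :=
  let generic := qbracket q (qbracket q (uF i) (uF i.+1)) (uF i.-1) in
  if odd n then
    if i == n.-1 then qbracket q (uF n) (uF n.-2)
    else if i == n then qbracket q (uF n.-1) (uF n.-2)
    else generic
  else
    if i == n then uF n else generic.

Definition c_alpha (i : nat) : C :=
  let generic := - q * (z i.+1 / z i.-1) in
  if odd n then
    if i == n.-1 then 'i / (q ^+ n.-1 * z n.-2)
    else if i == n then - ('i / (q ^+ n.-1 * z n.-2))
    else generic
  else
    if i == n then - (q ^+ (n.*2 - 3) * z n.-1 ^+ 2)^-1 else generic.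

Definition hdiff (i : nat) : nat -> int := fun j => tilde_alpha i j - kron j i.

Definition X_alpha (i : nat) : Uq n q :=
  uqh n q (hdiff i) * ue n q i + c_alpha i *: uF_tilde i.

Definition Uk_gens : set (Uq n q) :=
  [set x : Uq n q | exists i : nat, (0 < i <= n)%N /\
    if in_Pi_l i
    then [\/ x = ue n q i, x = uf n q i, x = uk n q i | x = uki n q i]
    else [\/ x = X_alpha i, x = uqh n q (hdiff i)
          | x = uqh n q (fun j => - hdiff i j)]]%classic.

Definition Uk : set (Uq n q) := subalg_gen Uk_gens.

Definition matA : 'M[C]_(n.*2) :=
  \sum_(1 <= i < n.*2 | odd i)
    z i *: (matE C n i (bar n i).-1 - matE C n i.+1 (bar n i)).

End CoidealSubalgebra.

Arguments Uk {C} n q z.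
Arguments matA {C} n z.

(* Main.v *)
(* A is a monomial matrix whose permutation of the indices is an involution,  *)
(* and the condition on the z_i says that A^2 is a nonzero scalar. A diagonal *)
(* matrix commutes with A when its entries are invariant under the            *)
(* involution, and x + A x A^-1 commutes with A for every x. The generators   *)
(* q^h of U_q(k) are of the first kind; every other generator is a sum of    *)
(* matrices x + A x A^-1 with x a multiple of a matrix unit, where the terms  *)
(* of e_i are completed by those of F_{tilde alpha_i} (or, in the Levi part,  *)
(* the two terms of e_i, respectively f_i, are conjugate to each other).      *)

Require Import Defs.
From HB Require Import structures.
From mathcomp Require Import all_boot all_order all_algebra.
From mathcomp Require Import boolp classical_sets reals.
From mathcomp Require Import complex.
From mathcomp Require Import zify ring.

Set Implicit Arguments.
Unset Strict Implicit.
Unset Printing Implicit Defensive.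

Import Order.TTheory GRing.Theory Num.Theory.
Local Open Scope ring_scope.

(** The elements whose image commutes with [A] form a subalgebra, so it is enough to treat the
    generators. [A] is monomial: its nonzero entries sit at the positions (b, s(b)) for the
    parity-preserving involution s = [Acol], and [z_prod] makes A^2 the nonzero scalar K = -q^(2-2n)
    ([Aentry_prod]). Hence u E_{a,b} + v E_{s(a),s(b)} commutes with [A] as soon as one scalar
    equation holds, u A_b = v A_a, where A_b is [Aentry b] ([matE_pair_comm]).

    The image of each [X_alpha] has four matrix units, two from e_i and two from [uF_tilde], and s
    matches each of the first two with one of the last two. The constant [c_alpha] solves the
    equations of both pairs at once, thanks to the relations between the z_i. For odd n the
    involution fixes n and n', and [z_mid] says which square root of K is the entry z_n that enters
    [c_alpha]. The torus generators act by diagonal matrices that are constant on the orbits of s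
    ([root_expo_Acol]). *)

Section Involution.
Variable n : nat.

(* A has exactly one nonzero entry in row b: the entry Aentry b, in column    *)
(* Acol b.                                                                    *)
Definition Acol (b : nat) : nat := if odd b then (bar n b).-1 else (bar n b).+1.

Lemma Acol_bound b : (0 < b <= n.*2)%N -> (0 < Acol b <= n.*2)%N.
Proof. by rewrite /Acol /bar; case: ifP; lia. Qed.

Lemma AcolK b : (0 < b <= n.*2)%N -> Acol (Acol b) = b.
Proof. by rewrite /Acol /bar => hb; case: ifP; case: ifP; lia. Qed.

Lemma kron_Acol a b : (0 < a <= n.*2)%N -> (0 < b <= n.*2)%N ->
  kron (Acol b) a = kron b (Acol a).
Proof.
move=> ha hb; congr (nat_of_bool _)%:Z.
by apply/eqP/eqP => [<-|->]; rewrite AcolK.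
Qed.

(** The involution swaps i with (i+1)' and i+1 with i', and h_i has equal exponents on the two
    members of each swapped pair. *)
Lemma expo_h_Acol i b : odd i -> (0 < i < n)%N -> (0 < b <= n.*2)%N ->
  expo_h n i (Acol b) = expo_h n i b.
Proof.
move=> oi hi hb; have [_ hin] := andP hi; rewrite /expo_h hin.
have ci : Acol i = bar n i.+1 by rewrite /Acol oi /bar; lia.
have ci' : Acol i.+1 = bar n i by rewrite /Acol oddS oi /bar /=; lia.
rewrite !kron_Acol; try by rewrite /bar; lia.
rewrite -ci -ci' !AcolK ?ci ?ci'; lia.
Qed.

(** In h_n - h_{n-1} only the exponents at n and n' survive, and these two indices are fixed by the
    involution when n is odd. *)
Lemma expo_h_fork_Acol b : odd n -> (1 < n)%N -> (0 < b <= n.*2)%N ->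
  expo_h n n (Acol b) - expo_h n n.-1 (Acol b) = expo_h n n b - expo_h n n.-1 b.
Proof.
move=> on n1 hb; have n0 := ltnW n1.
rewrite /expo_h ltnn ltn_predL n0 prednK //.
have c1 : Acol n = n by rewrite /Acol on /bar; lia.
have c2 : Acol (bar n n) = bar n n by rewrite /Acol /bar; case: ifP; lia.
by rewrite !(kron_Acol (b := b)) ?c1 ?c2; rewrite /bar; lia.
Qed.

End Involution.

(** * Products of matrix units with [A], and matrices that commute with it *)

Section Matrices.
Variables (C : numClosedFieldType) (n : nat) (q : C) (z : nat -> C).
Hypotheses (n_ge3 : (3 <= n)%N) (q_neq0 : q != 0).
Local Notation E := (matE C n).
Local Notation A := (matA n z).
Local Notation col := (Acol n).
Local Notation mE := (mulE n_ge3 q_neq0).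

Definition Aentry (b : nat) : C := if odd b then z b else - z b.-1.

Lemma mulEA a b : (0 < b <= n.*2)%N -> E a b *m A = Aentry b *: E a (col b).
Proof.
move=> hb; rewrite mulmx_sumr big_mkcond /=.
(* The odd index of the only summand of [A] with a nonzero entry in row b. *)
have hm : (if odd b then b else b.-1) \in index_iota 1 n.*2.
  by rewrite mem_index_iota; case: ifP; lia.
rewrite (bigD1_seq _ hm) ?iota_uniq //= big1 => [|i hi].
  rewrite addr0 /Aentry /Acol; case ob: (odd b) => /=.
    rewrite ob -scalemxAr mulmxBr !mE // eqxx scale1r.
    by rewrite (_ : (b == b.+1) = false) ?scale0r ?subr0 //; lia.
  rewrite ifT; last by lia.
  rewrite -scalemxAr mulmxBr !mE // (_ : (b == b.-1) = false); last by lia.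
  rewrite (_ : (b == b.-1.+1) = true); last by lia.
  rewrite scale0r scale1r sub0r scalerN scaleNr.
  by congr (- (_ *: E _ _)); rewrite /bar; lia.
case: ifP => // oi; rewrite -scalemxAr mulmxBr !mE //.
rewrite (_ : (b == i) = false); last by move: hi; case: ifP; lia.
rewrite (_ : (b == i.+1) = false); last by move: hi; case: ifP; lia.
by rewrite !scale0r subr0 scaler0.
Qed.

Lemma matA_sum : A = \sum_(1 <= b < n.*2.+1) Aentry b *: E b (col b).
Proof.
rewrite -[LHS]mul1mx -dgm1 -diagE mulmx_suml; apply: eq_big_nat => b hb.
by rewrite scale1r mulEA.
Qed.

Lemma mulAE a b : (0 < a <= n.*2)%N ->
  A *m E a b = Aentry (col a) *: E (col a) b.
Proof.
move=> ha; rewrite matA_sum mulmx_suml.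
have hm : col a \in index_iota 1 n.*2.+1.
  by rewrite mem_index_iota; apply: Acol_bound.
rewrite (bigD1_seq _ hm) ?iota_uniq //= big1_seq => [|i].
  rewrite addr0 -scalemxAl AcolK // mE //.
  by rewrite eqxx scale1r.
rewrite mem_index_iota => /andP[ia hi]; rewrite -scalemxAl mE ?Acol_bound //.
case: eqP => [ca|_]; last by rewrite scale0r scaler0.
by move: ia; rewrite -ca AcolK // eqxx.
Qed.

Lemma dgm_comm (x : nat -> C) :
  (forall b, (0 < b <= n.*2)%N -> x (col b) = x b) ->
  dgm n x *m A = A *m dgm n x.
Proof.
move=> xcol; rewrite matA_sum mulmx_suml mulmx_sumr.
apply: eq_big_nat => b hb; rewrite -scalemxAl -scalemxAr; congr (_ *: _).
have := conjE x (fun=> 1) hb (Acol_bound hb).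
have := conjE (fun=> 1) x hb (Acol_bound hb).
by rewrite !dgm1 mul1mx mulmx1 => -> ->; rewrite mulr1 mul1r xcol.
Qed.

Hypothesis z_prod : forall i : nat, odd i -> (i <= n)%N ->
  z i * z (bar n i).-1 = - q ^ (2 - n.*2%:Z).

Local Notation K := (- q ^ (2 - n.*2%:Z)).

(** The map i -> i' - 1 exchanges the odd indices above n with odd indices below n, and the product
    is symmetric under it. *)
Lemma z_prod_all i : odd i -> (i < n.*2)%N -> z i * z (bar n i).-1 = K.
Proof.
move=> oi hi; have [|ni] := leqP i n; first exact: z_prod.
rewrite -(z_prod (i := (bar n i).-1)); try by rewrite /bar; lia.
by rewrite mulrC; congr (_ * z _); rewrite /bar; lia.
Qed.

(** This is A^2 = K, read off on the diagonal; in even rows the two minus signs cancel. *)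
Lemma Aentry_prod b : (0 < b <= n.*2)%N -> Aentry b * Aentry (col b) = K.
Proof.
move=> hb; rewrite /Aentry /Acol; case: ifP => ob.
  rewrite ifT; last by rewrite /bar; lia.
  by rewrite z_prod_all //; lia.
rewrite ifF; last by rewrite /bar; lia.
rewrite mulrNN -(z_prod_all (i := b.-1)); try lia.
by congr (_ * z _); rewrite /bar; lia.
Qed.

Lemma K_neq0 : K != 0.
Proof. by rewrite oppr_eq0 expfz_neq0. Qed.

Lemma z_neq0 i : odd i -> (i < n.*2)%N -> z i != 0.
Proof.
move=> oi hi; apply: contra_neq K_neq0 => zi.
by rewrite -(z_prod_all oi hi) zi mul0r.
Qed.

(* The second summand is the conjugate of the first one by A. *)
Lemma matE_pair_comm a b (u v : C) :
  (0 < a <= n.*2)%N -> (0 < b <= n.*2)%N -> u * Aentry b = v * Aentry a ->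
  (u *: E a b + v *: E (col a) (col b)) *m A =
  A *m (u *: E a b + v *: E (col a) (col b)).
Proof.
move=> ha hb uv.
(* The hypothesis settles position (a, [col b]); this settles the other one, ([col a], b), by
   multiplying through by K. *)
have vu : v * Aentry (col b) = u * Aentry (col a).
  apply: (mulfI K_neq0); rewrite -{1}(Aentry_prod ha) -(Aentry_prod hb).
  transitivity (v * Aentry a * Aentry (col a) * Aentry (col b)); first by ring.
  by rewrite -uv; ring.
rewrite mulmxDl mulmxDr -!scalemxAl -!scalemxAr !mulEA ?mulAE ?Acol_bound //.
by rewrite !AcolK // !scalerA uv vu addrC.
Qed.

End Matrices.

(** * Images of torus elements and root vectors in the natural representation *)

Section Representation.
Variables (C : numClosedFieldType) (n : nat) (q : C) (z : nat -> C).
Hypotheses (n_ge3 : (3 <= n)%N) (q_neq0 : q != 0).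
Hypothesis q_nroot : forall m, (0 < m)%N -> q ^+ m != 1.
Local Notation E := (matE C n).
Local Notation A := (matA n z).
Local Notation rep := (natrep n_ge3 q_neq0 q_nroot).
Local Notation mE := (mulE n_ge3 q_neq0).

Lemma dgmX (x : nat -> C) p : dgm n x ^+ p = dgm n (fun j => x j ^+ p).
Proof.
elim: p => [|p IHp]; first by rewrite expr0 [LHS](esym (dgm1 C n)).
rewrite exprS IHp [LHS]dgmM; congr dgm; apply: funext => j.
by rewrite exprS.
Qed.

Lemma natrep_ukpow i (m : int) : (0 < i <= n)%N ->
  rep (ukpow n q i m) = dgm n (fun j => q ^ (m * expo_h n i j)).
Proof.
move=> hi; case: m => p; rewrite /ukpow rmorphXn /=.
  rewrite natrep_uk // kE dgmX; congr dgm; apply: funext => j.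
  by rewrite exprnP exprz_exp mulrC.
rewrite natrep_uki // kiE dgmX; congr dgm; apply: funext => j.
by rewrite exprnP exprz_exp NegzE !mulNr mulrC.
Qed.

(** The pairing of beta with the weight of the j-th basis vector. *)
Definition root_expo (beta : nat -> int) (j : nat) : int :=
  \sum_(1 <= i < n.+1) beta i * expo_h n i j.

Lemma natrep_uqh beta :
  rep (uqh n q beta) = dgm n (fun j => q ^ root_expo beta j).
Proof.
rewrite /uqh rmorph_prod /=.
transitivity (\prod_(1 <= i < n.+1)
    dgm n (fun j => q ^ (beta i * expo_h n i j))).
  by apply: eq_big_nat => i hi; rewrite natrep_ukpow.
rewrite /root_expo; elim: (index_iota _ _) => [|i r IHr].
  rewrite big_nil [LHS](esym (dgm1 C n)).
  by congr dgm; apply: funext => j; rewrite big_nil.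
rewrite big_cons IHr [LHS]dgmM.
by congr dgm; apply: funext => j; rewrite big_cons expfzDr.
Qed.

Lemma dgm_mulE (x : nat -> C) a b : (0 < a <= n.*2)%N -> (0 < b <= n.*2)%N ->
  dgm n x *m E a b = x a *: E a b.
Proof.
move=> ha hb; have := conjE x (fun=> 1) ha hb.
by rewrite dgm1 mulmx1 mulr1.
Qed.

Lemma natrepM x y : rep (x * y) = rep x *m rep y.
Proof. exact: rmorphM. Qed.

(* The diagonal entries of q^{h_i} that meet f_i are both q^{-1}. *)
Lemma natrep_uF i : (0 < i <= n)%N -> rep (uF n q i) = q^-1 *: mat_f C n i.
Proof.
move=> hi; rewrite /uF natrepM natrep_uk // natrep_uf //.
rewrite kE /mat_f; case: ifP => hin; rewrite mulmxBr !dgm_mulE;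
  try by rewrite /bar; lia.
  have -> : expo_h n i i.+1 = -1 by rewrite /expo_h hin /kron /bar; lia.
  have -> : expo_h n i (bar n i) = -1 by rewrite /expo_h hin /kron /bar; lia.
  by rewrite scalerBr.
have ein : i = n by lia.
have -> : expo_h n i n.+1 = -1 by rewrite /expo_h hin /kron /bar; lia.
have -> : expo_h n i (bar n n.-1) = -1 by rewrite /expo_h hin /kron /bar; lia.
by rewrite scalerBr.
Qed.

Lemma natrep_qbracket a x y b c X Y : rep x = b *: X -> rep y = c *: Y ->
  rep (qbracket a x y) = (b * c) *: (X *m Y - a *: (Y *m X)).
Proof.
move=> hX hY; rewrite /qbracket rmorphB /= natrepZ !natrepM hX hY.
rewrite -!scalemxAl -!scalemxAr !scalerA scalerBr !scalerA.
by congr (_ - _ *: _); ring.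
Qed.

Lemma root_exposN beta j :
  root_expo (fun i => - beta i) j = - root_expo beta j.
Proof. by rewrite -sumrN; apply: eq_bigr => i _; rewrite mulNr. Qed.

Lemma kron_expo_sum a j : (0 < a <= n)%N ->
  \sum_(1 <= i < n.+1) kron i a * expo_h n i j = expo_h n a j.
Proof.
move=> ha; under eq_bigr do rewrite mulrC.
exact: (sum_kron (expo_h n ^~ j)).
Qed.

Lemma root_expo_even i j : ~~ odd i -> (0 < i < n.-1)%N ->
  root_expo (hdiff n i) j = expo_h n i.-1 j + expo_h n i.+1 j.
Proof.
move=> oi hi; rewrite -!kron_expo_sum -?big_split; try lia.
apply: eq_bigr => k _ /=; rewrite /hdiff /tilde_alpha.
have -> : (i == n) = false by lia.
have -> : (i == n.-1) = false by lia.
by case: ifP => _; ring.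
Qed.

Lemma root_expo_even_last j : ~~ odd n -> root_expo (hdiff n n) j = 0.
Proof.
move=> on; apply: big1 => k _; rewrite /hdiff /tilde_alpha (negbTE on) eqxx.
by rewrite subrr mul0r.
Qed.

Lemma root_expo_odd_pred j : odd n ->
  root_expo (hdiff n n.-1) j = expo_h n n.-2 j + expo_h n n j - expo_h n n.-1 j.
Proof.
move=> on; rewrite -!kron_expo_sum -?sumrN -?big_split; try lia.
apply: eq_bigr => k _ /=; rewrite /hdiff /tilde_alpha on eqxx.
by ring.
Qed.

Lemma root_expo_odd_last j : odd n ->
  root_expo (hdiff n n) j = expo_h n n.-2 j + expo_h n n.-1 j - expo_h n n j.
Proof.
move=> on; rewrite -!kron_expo_sum -?sumrN -?big_split; try lia.
apply: eq_bigr => k _ /=; rewrite /hdiff /tilde_alpha on eqxx.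
have -> : (n == n.-1) = false by lia.
by ring.
Qed.

(** The node n-1 is outside the Levi part only when it is even, that is, for n odd; the node n
    always is. *)
Lemma not_in_Pi_l i : (0 < i <= n)%N -> in_Pi_l n i = false ->
  [\/ ~~ odd i /\ (0 < i < n.-1)%N, ~~ odd n /\ i = n,
      odd n /\ i = n.-1 | odd n /\ i = n].
Proof.
rewrite /in_Pi_l => hi Pi.
have [hin|hin] := ltnP i n.-1; first by constructor 1; split; lia.
have [ein|nin] := eqVneq i n.
  by case on: (odd n); [constructor 4|constructor 2].
by constructor 3; split; lia.
Qed.

(** The difference of roots is a sum of Levi roots, zero, or the Levi root alpha_{n-2} plus or minus
    the fork difference alpha_n - alpha_{n-1}; each is invariant under the involution. *)
Lemma root_expo_Acol i b : (0 < i <= n)%N -> in_Pi_l n i = false ->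
  (0 < b <= n.*2)%N ->
  root_expo (hdiff n i) (Acol n b) = root_expo (hdiff n i) b.
Proof.
move=> hi Pi hb; case: (not_in_Pi_l hi Pi) => - [on ei].
- by rewrite !root_expo_even // !expo_h_Acol //; lia.
- by rewrite ei !root_expo_even_last.
- rewrite ei !root_expo_odd_pred // -!addrA expo_h_fork_Acol //; last by lia.
  by rewrite expo_h_Acol //; lia.
- rewrite ei !root_expo_odd_last // -!addrA -!(opprB (expo_h n n _)).
  rewrite expo_h_fork_Acol //; last by lia.
  by rewrite expo_h_Acol //; lia.
Qed.

(** * Matrix units in the images of [uF_tilde] and [X_alpha] *)

Ltac decide_eqs := repeat match goal with |- context[@eq_op ?T ?x ?y] =>
  first [ have -> : @eq_op T x y = false by rewrite /bar; lia
        | have -> : @eq_op T x y = true by rewrite /bar; lia ] end.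

Lemma mat_f_lt i : (i < n)%N -> mat_f C n i = E i.+1 i - E (bar n i) (bar n i.+1).
Proof. by rewrite /mat_f => ->. Qed.

Lemma mat_f_last : mat_f C n n = E n.+1 n.-1 - E (bar n n.-1) n.
Proof. by rewrite /mat_f ltnn (_ : bar n n.+1 = n) // /bar; lia. Qed.

Ltac simp_matE :=
  rewrite !(mulmxBl, mulmxBr) -?scalemxAl -?scalemxAr !mE;
  try (by rewrite /bar; lia); decide_eqs;
  rewrite !(scale0r, scale1r, scaler0, subr0, sub0r, addr0, add0r, oppr0, opprK).

(** Each order of multiplication leaves one matrix unit. The three [uF] factors give q^-3, and each
    surviving term picks up one q from the two brackets. *)
Lemma natrep_uF_tilde_even i : ~~ odd i -> (0 < i < n.-1)%N ->
  rep (uF_tilde n q i) =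
  q ^- 2 *: (E (bar n i.-1) (bar n i.+2) - E i.+2 i.-1).
Proof.
move=> oi hi; rewrite /uF_tilde.
have -> : (i == n) = false by lia.
have -> : (i == n.-1) = false by lia.
have P1 : mat_f C n i *m mat_f C n i.+1 = E (bar n i) (bar n i.+2).
  by rewrite !mat_f_lt; try lia; simp_matE.
have P2 : mat_f C n i.+1 *m mat_f C n i = E i.+2 i.
  by rewrite !mat_f_lt; try lia; simp_matE.
rewrite !if_same (natrep_qbracket _ (natrep_qbracket _ (natrep_uF _) (natrep_uF _)) (natrep_uF _)); try lia.
rewrite P1 P2 mat_f_lt ?(prednK (n := i)); try lia.
simp_matE.
rewrite scalerN opprK addrC -scalerBr scalerA; congr (_ *: _).
by field.
Qed.

Lemma natrep_uF_tilde_even_last : ~~ odd n ->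
  rep (uF_tilde n q n) = q^-1 *: (E n.+1 n.-1 - E n.+2 n).
Proof.
move=> on; rewrite /uF_tilde (negbTE on) eqxx natrep_uF ?mat_f_last; last by lia.
by have -> : bar n n.-1 = n.+2 by rewrite /bar; lia.
Qed.

(** With a single bracket only one of the two terms receives the factor q; this imbalance is matched
    by the action of q^h on the rows of e_{n-1}. *)
Lemma natrep_uF_tilde_odd_pred : odd n ->
  rep (uF_tilde n q n.-1) = q ^- 2 *: (E n.+1 n.-2 - q *: E n.+3 n).
Proof.
move=> on; rewrite /uF_tilde on eqxx.
rewrite (natrep_qbracket _ (natrep_uF _) (natrep_uF _)); try lia.
rewrite mat_f_last mat_f_lt; last by lia.
have -> : n.-2.+1 = n.-1 by lia.
have -> : bar n n.-2 = n.+3 by rewrite /bar; lia.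
have -> : bar n n.-1 = n.+2 by rewrite /bar; lia.
simp_matE; congr (_ *: _).
by rewrite -exprVn expr2.
Qed.

Lemma natrep_uF_tilde_odd_last : odd n ->
  rep (uF_tilde n q n) = q ^- 2 *: (E n n.-2 - q *: E n.+3 n.+1).
Proof.
move=> on; rewrite /uF_tilde on eqxx.
have -> : (n == n.-1) = false by lia.
rewrite (natrep_qbracket _ (natrep_uF _) (natrep_uF _)); try lia.
rewrite !mat_f_lt; try by lia.
have -> : n.-2.+1 = n.-1 by lia.
have -> : bar n n.-2 = n.+3 by rewrite /bar; lia.
have -> : bar n n.-1 = n.+2 by rewrite /bar; lia.
have -> : n.-1.+1 = n by lia.
have -> : bar n n = n.+1 by rewrite /bar; lia.
simp_matE; congr (_ *: _).
by rewrite -exprVn expr2.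
Qed.

Lemma natrep_X_alpha i : (0 < i <= n)%N ->
  rep (X_alpha n q z i) =
  dgm n (fun j => q ^ root_expo (hdiff n i) j) *m mat_e C n i
  + c_alpha n q z i *: rep (uF_tilde n q i).
Proof.
by move=> hi; rewrite /X_alpha rmorphD /= natrepZ natrepM natrep_uqh natrep_ue.
Qed.

Lemma mat_e_lt i : (i < n)%N -> mat_e C n i = E i i.+1 - E (bar n i.+1) (bar n i).
Proof. by rewrite /mat_e => ->. Qed.

Lemma mat_e_last : mat_e C n n = E n.-1 n.+1 - E n n.+2.
Proof.
rewrite /mat_e ltnn; have -> : bar n n.+1 = n by rewrite /bar; lia.
by have -> : bar n n.-1 = n.+2 by rewrite /bar; lia.
Qed.

(** * Each generator commutes with [A] *)

Hypothesis z_prod : forall i : nat, odd i -> (i <= n)%N ->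
  z i * z (bar n i).-1 = - q ^ (2 - n.*2%:Z).
Hypothesis z_mid : odd n -> z n = 'i * q ^ (1 - n%:Z).

Local Notation col := (Acol n).
Local Notation entry := (Aentry z).

Lemma matE_pairs_comm a b c d u v s t :
  (0 < a <= n.*2)%N -> (0 < b <= n.*2)%N ->
  (0 < c <= n.*2)%N -> (0 < d <= n.*2)%N ->
  u * entry b = v * entry a -> s * entry d = t * entry c ->
  let M := u *: E a b + v *: E (col a) (col b)
           + (s *: E c d + t *: E (col c) (col d)) in
  M *m A = A *m M.
Proof.
move=> ha hb hc hd uv st M.
rewrite mulmxDl mulmxDr (matE_pair_comm n_ge3 q_neq0 z_prod ha hb uv).
by rewrite (matE_pair_comm n_ge3 q_neq0 z_prod hc hd st).
Qed.

(** The two terms of e_i already form a conjugate pair; their opposite signs match the entries z_i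
    and -z_i of [A] in rows i and i+1. *)
Lemma Levi_e_comm i : odd i -> (0 < i < n)%N ->
  mat_e C n i *m A = A *m mat_e C n i.
Proof.
move=> oi hi; have ci : bar n i.+1 = col i by rewrite /Acol oi /bar; lia.
have ci' : bar n i = col i.+1 by rewrite /Acol oddS oi /= /bar; lia.
rewrite mat_e_lt; last by lia.
rewrite ci ci' -[E i i.+1]scale1r -scaleN1r.
apply: (matE_pair_comm n_ge3 q_neq0 z_prod); try lia.
by rewrite /Aentry oddS oi /=; ring.
Qed.

Lemma Levi_f_comm i : odd i -> (0 < i < n)%N ->
  mat_f C n i *m A = A *m mat_f C n i.
Proof.
move=> oi hi; have ci : bar n i.+1 = col i by rewrite /Acol oi /bar; lia.
have ci' : bar n i = col i.+1 by rewrite /Acol oddS oi /= /bar; lia.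
rewrite mat_f_lt; last by lia.
rewrite ci ci' -[E i.+1 i]scale1r -scaleN1r.
apply: (matE_pair_comm n_ge3 q_neq0 z_prod); try lia.
by rewrite /Aentry oddS oi /=; ring.
Qed.

Lemma X_alpha_even_comm i : ~~ odd i -> (0 < i < n.-1)%N ->
  rep (X_alpha n q z i) *m A = A *m rep (X_alpha n q z i).
Proof.
move=> oi hi; have hin : (0 < i <= n)%N by lia.
have zi : z i.-1 != 0 by apply: (z_neq0 n_ge3 q_neq0 z_prod); lia.
have c1 : col i = bar n i.-1 by rewrite /Acol (negbTE oi) /bar; lia.
have c2 : col i.+1 = bar n i.+2 by rewrite /Acol oddS oi /bar /=; lia.
have c3 : col (bar n i.+1) = i.+2.
  by rewrite /Acol ifF /bar; lia.
have c4 : col (bar n i) = i.-1.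
  by rewrite /Acol ifT /bar; lia.
have lt1 : (i.-1 < n)%N by lia.
have lt2 : (i.+1 < n)%N by lia.
have x1 : root_expo (hdiff n i) i = -1.
  rewrite root_expo_even // /expo_h lt1 lt2.
  by rewrite /kron; decide_eqs.
have x2 : root_expo (hdiff n i) (bar n i.+1) = -1.
  rewrite root_expo_even // /expo_h lt1 lt2.
  by rewrite /kron; decide_eqs.
rewrite natrep_X_alpha // natrep_uF_tilde_even // mat_e_lt; last by lia.
rewrite mulmxBr !dgm_mulE ?x1 ?x2; try by rewrite /bar; lia.
have -> : c_alpha n q z i = - q * (z i.+1 / z i.-1).
  rewrite /c_alpha; have -> : (i == n) = false by lia.
  by rewrite (_ : (i == n.-1) = false) ?if_same; last by lia.
rewrite scalerA; set c := (X in X *: (_ - _)).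
(* Regrouping puts each term of e_i next to its conjugate from [uF_tilde]. *)
have -> : q ^ (-1) *: E i i.+1 - q ^ (-1) *: E (bar n i.+1) (bar n i) +
    c *: (E (bar n i.-1) (bar n i.+2) - E i.+2 i.-1) =
    q^-1 *: E i i.+1 + c *: E (col i) (col i.+1) +
    (- q^-1 *: E (bar n i.+1) (bar n i)
     + - c *: E (col (bar n i.+1)) (col (bar n i))).
  by rewrite c1 c2 c3 c4 -exprN1 scalerBr !scaleNr addrACA.
apply: matE_pairs_comm; try by rewrite /bar; lia.
  rewrite /Aentry oddS oi (negbTE oi) /= /c.
  by field; rewrite q_neq0 zi.
have z1 := z_prod (i := i.-1); have z2 := z_prod (i := i.+1).
rewrite /Aentry ifT; last by rewrite /bar; lia.
rewrite ifF; last by rewrite /bar; lia.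
(* Both sides equal K, because i' = (i-1)' - 1. The first pair already holds by the choice of
   [c_alpha]; this identity gives the second. *)
have zz : z i.+1 * z (bar n i.+1).-1 = z i.-1 * z (bar n i).
  rewrite z2 -?z1; try lia.
  by congr (_ * z _); rewrite /bar; lia.
rewrite /c; transitivity (- (q^-1 / z i.-1) * (z i.-1 * z (bar n i))).
  by field; rewrite q_neq0 zi.
by rewrite -zz; field; rewrite q_neq0 zi.
Qed.

Lemma X_alpha_even_last_comm : ~~ odd n ->
  rep (X_alpha n q z n) *m A = A *m rep (X_alpha n q z n).
Proof.
move=> on; have z1 : z n.-1 != 0 by apply: (z_neq0 n_ge3 q_neq0 z_prod); lia.
have c1 : col n.-1 = n.+1 by rewrite /Acol ifT /bar; lia.
have c2 : col n.+1 = n.-1 by rewrite /Acol oddS on /bar; lia.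
have c3 : col n = n.+2 by rewrite /Acol (negbTE on) /bar; lia.
have c4 : col n.+2 = n by rewrite /Acol !oddS (negbTE on) /bar /=; lia.
rewrite natrep_X_alpha ?natrep_uF_tilde_even_last // ?mat_e_last; last by lia.
rewrite mulmxBr !dgm_mulE ?root_expo_even_last ?expr0z; try lia.
set c := c_alpha n q z n.
have -> : 1 *: E n.-1 n.+1 - 1 *: E n n.+2 +
    c *: (q^-1 *: (E n.+1 n.-1 - E n.+2 n)) =
    1 *: E n.-1 n.+1 + (c / q) *: E (col n.-1) (col n.+1) +
    (- 1 *: E n n.+2 + - (c / q) *: E (col n) (col n.+2)).
  by rewrite c1 c2 c3 c4 scalerA scalerBr !scaleNr addrACA.
(* Both pairs reduce to this one equation. It holds because z_{n-1} z_{n+1} = K, which explains the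
   square of z_{n-1} in [c_alpha]. *)
have zn : z n.+1 = c / q * z n.-1.
  apply: (mulfI z1); rewrite [n.+1](_ : _ = (bar n n.-1).-1); last first.
    by rewrite /bar; lia.
  rewrite z_prod ?/c ?/c_alpha ?(negbTE on) ?eqxx; try lia.
  (* The natural subtraction in the exponent of [c_alpha] does not truncate, as n is at least 3. *)
  have -> : 2 - n.*2%:Z = - (n.*2 - 3).+1%:Z by lia.
  rewrite -exprnN exprS.
  by field; rewrite q_neq0 z1 expf_neq0.
have en1 : odd n.-1 by lia.
apply: matE_pairs_comm; try lia.
  by rewrite /Aentry oddS on en1 zn mul1r.
by rewrite /Aentry !oddS (negbTE on) /= zn; ring.
Qed.

Section FixedMiddleCoefficient.
Hypothesis n_odd : odd n.

Let oddn1 : odd n.-1 = false. Proof. lia. Qed.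

Lemma z_pred2_neq0 : z n.-2 != 0.
Proof. by apply: (z_neq0 n_ge3 q_neq0 z_prod); lia. Qed.

(** For odd n, both z_{n-2} z_{n+2} and z_n^2 equal K. *)
Lemma z_succ2 : z n.+2 = z n ^+ 2 / z n.-2.
Proof.
have h1 : z n.-2 * z n.+2 = - q ^ (2 - n.*2%:Z).
  rewrite -(z_prod (i := n.-2)); try lia.
  by congr (_ * z _); rewrite /bar; lia.
have h2 : z n * z n = - q ^ (2 - n.*2%:Z).
  rewrite -(z_prod (i := n)) //.
  by congr (_ * z _); rewrite /bar; lia.
by rewrite expr2 h2 -h1 mulrC mulKf ?z_pred2_neq0.
Qed.

(** Here the choice of square root in [z_mid] enters: [z_prod] alone fixes z_n only up to sign. *)
Lemma c_alpha_middle : 'i / (q ^+ n.-1 * z n.-2) = z n / z n.-2.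
Proof.
rewrite z_mid // invfM mulrA; congr (_ * _ / _).
have -> : 1 - n%:Z = - n.-1%:Z by lia.
by rewrite -exprnN.
Qed.

Let col_pred : col n.-1 = n.+3.
Proof. by rewrite /Acol oddn1 /bar; lia. Qed.
Let col_n : col n = n.
Proof. by rewrite /Acol n_odd /bar; lia. Qed.
Let col_succ : col n.+1 = n.+1.
Proof. by rewrite /Acol oddS n_odd /bar /=; lia. Qed.
Let col_succ2 : col n.+2 = n.-2.
Proof. by rewrite /Acol !oddS n_odd /bar /=; lia. Qed.

(** The torus factor is q^-1 on row n-1 and q^-2 on row n+1. The first pair asks for c = z_n /
    z_{n-2}, the second for z_{n+2} = c z_n, which is [z_succ2]. *)
Lemma X_alpha_odd_pred_comm :
  rep (X_alpha n q z n.-1) *m A = A *m rep (X_alpha n q z n.-1).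
Proof.
have z2 := z_pred2_neq0.
have lt1 : (n.-1 < n)%N by lia.
have lt2 : (n.-2 < n)%N by lia.
have x1 : root_expo (hdiff n n.-1) n.-1 = -1.
  rewrite root_expo_odd_pred // /expo_h ltnn lt1 lt2.
  by rewrite /kron; decide_eqs.
have x2 : root_expo (hdiff n n.-1) n.+1 = -2%:Z.
  rewrite root_expo_odd_pred // /expo_h ltnn lt1 lt2.
  by rewrite /kron; decide_eqs.
rewrite natrep_X_alpha ?natrep_uF_tilde_odd_pred // ?mat_e_lt //; last by lia.
have -> : c_alpha n q z n.-1 = z n / z n.-2.
  by rewrite /c_alpha n_odd eqxx c_alpha_middle.
have -> : n.-1.+1 = n by lia.
have -> : bar n n = n.+1 by rewrite /bar; lia.
have -> : bar n n.-1 = n.+2 by rewrite /bar; lia.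
rewrite mulmxBr !dgm_mulE ?x1 ?x2; try lia.
set c := _ / _.
have -> : q ^ (-1) *: E n.-1 n - q ^ (- 2%:Z) *: E n.+1 n.+2 +
    c *: (q ^- 2 *: (E n.+1 n.-2 - q *: E n.+3 n)) =
    q^-1 *: E n.-1 n + - (c / q) *: E (col n.-1) (col n) +
    (- q ^- 2 *: E n.+1 n.+2 + (c * q ^- 2) *: E (col n.+1) (col n.+2)).
  rewrite col_pred col_n col_succ col_succ2 scalerA scalerBr scalerA.
  rewrite exprN1 -exprnN [X in _ + X = _]addrC addrACA -!scaleNr.
  congr (_ + _ *: _ + _).
  by field.
apply: matE_pairs_comm; try lia; rewrite /Aentry ?oddS n_odd ?oddn1 /=.
  by rewrite /c; field; rewrite q_neq0 z2.
by rewrite z_succ2 /c; field; rewrite q_neq0 z2.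
Qed.

(** Compared with node n-1, the indices n and n+1 are interchanged. Their entries in [A] are z_n and
    -z_n, hence the opposite sign of [c_alpha]. *)
Lemma X_alpha_odd_last_comm :
  rep (X_alpha n q z n) *m A = A *m rep (X_alpha n q z n).
Proof.
have z2 := z_pred2_neq0.
have lt1 : (n.-1 < n)%N by lia.
have lt2 : (n.-2 < n)%N by lia.
have x1 : root_expo (hdiff n n) n.-1 = -1.
  rewrite root_expo_odd_last // /expo_h ltnn lt1 lt2.
  by rewrite /kron; decide_eqs.
have x2 : root_expo (hdiff n n) n = -2%:Z.
  rewrite root_expo_odd_last // /expo_h ltnn lt1 lt2.
  by rewrite /kron; decide_eqs.
rewrite natrep_X_alpha ?natrep_uF_tilde_odd_last // ?mat_e_last //; last by lia.
have -> : c_alpha n q z n = - (z n / z n.-2).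
  rewrite /c_alpha n_odd eqxx c_alpha_middle.
  by rewrite (_ : (n == n.-1) = false); last by lia.
rewrite mulmxBr !dgm_mulE ?x1 ?x2; try lia.
set c := - (_ / _).
have -> : q ^ (-1) *: E n.-1 n.+1 - q ^ (- 2%:Z) *: E n n.+2 +
    c *: (q ^- 2 *: (E n n.-2 - q *: E n.+3 n.+1)) =
    q^-1 *: E n.-1 n.+1 + - (c / q) *: E (col n.-1) (col n.+1) +
    (- q ^- 2 *: E n n.+2 + (c * q ^- 2) *: E (col n) (col n.+2)).
  rewrite col_pred col_n col_succ col_succ2 scalerA scalerBr scalerA.
  rewrite exprN1 -exprnN [X in _ + X = _]addrC addrACA -!scaleNr.
  congr (_ + _ *: _ + _).
  by field.
apply: matE_pairs_comm; try lia; rewrite /Aentry ?oddS n_odd ?oddn1 /=.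
  by rewrite /c; field; rewrite q_neq0 z2.
by rewrite z_succ2 /c; field; rewrite q_neq0 z2.
Qed.

End FixedMiddleCoefficient.

(** * From the generators to the whole subalgebra *)

Lemma Uk_gens_comm x : Uk_gens z x -> rep x *m A = A *m rep x.
Proof.
case=> i [hi]; case: ifP => [/andP[oi hi1]|Pi].
  have hin : (0 < i < n)%N by lia.
  case=> ->.
  - by rewrite natrep_ue //; apply: Levi_e_comm.
  - by rewrite natrep_uf //; apply: Levi_f_comm.
  - rewrite natrep_uk // kE; apply: (dgm_comm _ n_ge3 q_neq0) => b hb.
    by rewrite expo_h_Acol.
  - rewrite natrep_uki // kiE; apply: (dgm_comm _ n_ge3 q_neq0) => b hb.
    by rewrite expo_h_Acol.
case=> ->.
- case: (not_in_Pi_l hi Pi) => - [on ei]; rewrite ?ei.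
  + exact: X_alpha_even_comm.
  + exact: X_alpha_even_last_comm.
  + exact: X_alpha_odd_pred_comm.
  + exact: X_alpha_odd_last_comm.
- rewrite natrep_uqh; apply: (dgm_comm _ n_ge3 q_neq0) => b hb.
  by rewrite root_expo_Acol.
- rewrite natrep_uqh; apply: (dgm_comm _ n_ge3 q_neq0) => b hb.
  by rewrite !root_exposN root_expo_Acol.
Qed.

Lemma natrep_centralizer_subalg :
  GRing.subalg_closed (mem [set x | rep x *m A = A *m rep x]%classic).
Proof.
split; rewrite ?inE /=.
- by rewrite rmorph1 [LHS]mul1mx [RHS]mulmx1.
- move=> a x y; rewrite !inE /= => hx hy.
  rewrite rmorphD /= natrepZ mulmxDl mulmxDr hy.
  by rewrite -scalemxAl -scalemxAr hx.
- move=> x y; rewrite !inE /= => hx hy.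
  by rewrite !natrepM -mulmxA hy !mulmxA hx.
Qed.

Lemma Uk_comm x : x \in Uk n q z -> rep x *m A = A *m rep x.
Proof.
(* [Uk] is the intersection of all subalgebras containing the generators, so membership applies
   directly to the set of elements commuting with [A]. *)
rewrite inE => ux; apply: (ux [set x | rep x *m A = A *m rep x]%classic).
by split; [apply: natrep_centralizer_subalg | move=> y; apply: Uk_gens_comm].
Qed.

End Representation.

Theorem mainTheorem8 (R : realType) (n : nat) (q : R[i]) (z : nat -> R[i])
    (n_ge3 : (3 <= n)%N)
    (q_neq0 : q != 0)
    (q_nroot : forall m : nat, (0 < m)%N -> q ^+ m != 1)
    (z_prod : forall i : nat, odd i -> (i <= n)%N ->
       z i * z (bar n i).-1 = - q ^ (2 - n.*2%:Z))
    (z_mid : odd n -> z n = 'i * q ^ (1 - n%:Z)) :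
  forall x : Uq n q, x \in Uk n q z ->
    natrep n_ge3 q_neq0 q_nroot x *m matA n z
    = matA n z *m natrep n_ge3 q_neq0 q_nroot x.
Proof. by move=> x; apply: Uk_comm. Qed.
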